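(* Let $p\ge 2$ be an integer, let $\mathbf{i}_{\mathbf{m}},\mathbf{i}_{\mathbf{k}},\mathbf{i}_{\mathbf{l}}\in\mathbb{I}(n)$ be pairwise distinct, and let $M=\mathrm{It}^p(\mathbf{i}_{\mathbf{m}},\mathbf{i}_{\mathbf{k}},\mathbf{i}_{\mathbf{l}})$. Then: 1. if $p$ is even and ($\mathbf{i}_{\mathbf{m}}=1$ or $\mathbf{i}_{\mathbf{k}}\mathbf{i}_{\mathbf{l}}=\pm\mathbf{i}_{\mathbf{m}}$), then $M=\mathbb{M}(1,\mathbf{i}_{\mathbf{k}},\mathbf{i}_{\mathbf{l}})$; 2. if $p$ is even, $\mathbf{i}_{\mathbf{m}}\neq1$ and $\mathbf{i}_{\mathbf{k}}\mathbf{i}_{\mathbf{l}}\neq\pm\mathbf{i}_{\mathbf{m}}$, then $M=\mathbb{S}(\mathbf{i}_{\mathbf{m}},\mathbf{i}_{\mathbf{k}},\mathbf{i}_{\mathbf{l}})$; 3. if $p$ is odd, then $M=\mathbb{M}(\mathbf{i}_{\mathbf{m}},\mathbf{i}_{\mathbf{k}},\mathbf{i}_{\mathbf{l}})$.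
   Context: Multicomplex numbers: $\mathbb{M}(0)=\mathbb{R}$ and, for $n\geq1$, $\mathbb{M}(n)=\{\eta_1+\eta_2 i_n:\eta_1,\eta_2\in\mathbb{M}(n-1)\}$ with $i_n^2=-1$, with operations $(\eta_1+\eta_2 i_n)+(\zeta_1+\zeta_2 i_n)=(\eta_1+\zeta_1)+(\eta_2+\zeta_2)i_n$ and $(\eta_1+\eta_2 i_n)(\zeta_1+\zeta_2 i_n)=(\eta_1\zeta_1-\eta_2\zeta_2)+(\eta_1\zeta_2+\eta_2\zeta_1)i_n$. This is a commutative unital ring and a real vector space. $\mathbb{I}(n)$ is the set of the $2^n$ products of distinct elements of $\{i_1,\dots,i_n\}$, including the empty product $1$; it is an $\mathbb{R}$-basis of $\mathbb{M}(n)$ and each element squares to $\pm1$. For $p\ge2$ and $c\in\mathbb{M}(n)$, $Q_{p,c}(\eta)=\eta^p+c$, and $Q_{p,c}^t$ is its $t$-th iterate. For pairwise distinct $\mathbf{i}_{\mathbf{m}},\mathbf{i}_{\mathbf{k}},\mathbf{i}_{\mathbf{l}}\in\mathbb{I}(n)$: $\mathbb{T}(\mathbf{i}_{\mathbf{m}},\mathbf{i}_{\mathbf{k}},\mathbf{i}_{\mathbf{l}})=\mathrm{span}_{\mathbb{R}}\{\mathbf{i}_{\mathbf{m}},\mathbf{i}_{\mathbf{k}},\mathbf{i}_{\mathbf{l}}\}$; $\mathrm{It}^p(\mathbf{i}_{\mathbf{m}},\mathbf{i}_{\mathbf{k}},\mathbf{i}_{\mathbf{l}})=\mathrm{span}_{\mathbb{R}}\{Q_{p,c}^t(0):c\in\mathbb{T}(\mathbf{i}_{\mathbf{m}},\mathbf{i}_{\mathbf{k}},\mathbf{i}_{\mathbf{l}}),\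 t\in\{1,2,3,\dots\}\}$; $\mathbb{M}(\mathbf{i}_{\mathbf{m}},\mathbf{i}_{\mathbf{k}},\mathbf{i}_{\mathbf{l}})=\mathrm{span}_{\mathbb{R}}\{\mathbf{i}_{\mathbf{m}},\mathbf{i}_{\mathbf{k}},\mathbf{i}_{\mathbf{l}},\mathbf{i}_{\mathbf{m}}\mathbf{i}_{\mathbf{k}}\mathbf{i}_{\mathbf{l}}\}$ (so $\mathbb{M}(1,\mathbf{i}_{\mathbf{k}},\mathbf{i}_{\mathbf{l}})=\mathrm{span}_{\mathbb{R}}\{1,\mathbf{i}_{\mathbf{k}},\mathbf{i}_{\mathbf{l}},\mathbf{i}_{\mathbf{k}}\mathbf{i}_{\mathbf{l}}\}$); $\mathbb{S}(\mathbf{i}_{\mathbf{m}},\mathbf{i}_{\mathbf{k}},\mathbf{i}_{\mathbf{l}})=\mathrm{span}_{\mathbb{R}}\{1,\mathbf{i}_{\mathbf{m}},\mathbf{i}_{\mathbf{k}},\mathbf{i}_{\mathbf{l}},\mathbf{i}_{\mathbf{m}}\mathbf{i}_{\mathbf{k}},\mathbf{i}_{\mathbf{m}}\mathbf{i}_{\mathbf{l}},\mathbf{i}_{\mathbf{k}}\mathbf{i}_{\mathbf{l}},\mathbf{i}_{\mathbf{m}}\mathbf{i}_{\mathbf{k}}\mathbf{i}_{\mathbf{l}}\}$. Standing convention: if one of the three units equals $1$, it is named $\mathbf{i}_{\mathbf{m}}$; thus $\mathbf{i}_{\mathbf{m}}\neq1$ means that none of $\mathbf{i}_{\mathbf{m}},\mathbf{i}_{\mathbf{k}},\mathbf{i}_{\mathbf{l}}$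 is $1$. *)

(* Defs.v *)
From HB Require Import structures.
From mathcomp Require Import all_boot all_order all_algebra.
From mathcomp Require Import boolp classical_sets reals.
Set Implicit Arguments.
Unset Strict Implicit.
Unset Printing Implicit Defensive.
Import Order.TTheory GRing.Theory Num.Theory.
Local Open Scope ring_scope.

(* A + A i with i^2 = -1, where x +i y stands for x + y i. *)
Record adjoin_i (A : Type) : Type := AdjoinI { fst_i : A; snd_i : A }.

Local Notation "x +i y" := (AdjoinI x y) (at level 50, left associativity).

Section AdjoinI.
Variables (R : comNzRingType) (A : comAlgType R).

Definition pair_of_adjoin_i (x : adjoin_i A) : A * A := (fst_i x, snd_i x).
Definition adjoin_i_of_pair (x : A * A) : adjoin_i A := x.1 +i x.2.

Lemma pair_of_adjoin_iK : cancel pair_of_adjoin_i adjoin_i_of_pair.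
Proof. by case. Qed.

HB.instance Definition _ := Choice.copy (adjoin_i A) (can_type pair_of_adjoin_iK).

Implicit Types x y : adjoin_i A.

Definition add_i x y := (fst_i x + fst_i y) +i (snd_i x + snd_i y).
Definition opp_i x := (- fst_i x) +i (- snd_i x).
Definition mul_i x y :=
  (fst_i x * fst_i y - snd_i x * snd_i y)
    +i (fst_i x * snd_i y + snd_i x * fst_i y).
Definition scale_i (a : R) x := (a *: fst_i x) +i (a *: snd_i x).

Lemma add_iA : associative add_i.
Proof. by move=> [a b] [c d] [e f]; rewrite /add_i /= !addrA. Qed.

Lemma add_iC : commutative add_i.
Proof. by move=> [a b] [c d]; rewrite /add_i /= addrC [b + d]addrC. Qed.

Lemma add_0i : left_id (0 +i 0) add_i.
Proof. by move=> [a b]; rewrite /add_i /= !add0r. Qed.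

Lemma add_Ni : left_inverse (0 +i 0) opp_i add_i.
Proof. by move=> [a b]; rewrite /add_i /= !addNr. Qed.

HB.instance Definition _ :=
  GRing.isZmodule.Build (adjoin_i A) add_iA add_iC add_0i add_Ni.

Lemma mul_iA : associative mul_i.
Proof.
move=> [a b] [c d] [e f]; rewrite /mul_i /=.
rewrite !mulrDr !mulrDl !mulrN !mulNr !mulrA !opprD -!addrA.
by congr ((_ + _) +i (_ + _)); rewrite !addrA addrAC;
  congr (_ + _); rewrite addrC.
Qed.

Lemma mul_iC : commutative mul_i.
Proof.
move=> [a b] [c d]; rewrite /mul_i /=.
by rewrite [c * b + _]addrC ![_ * c]mulrC ![_ * d]mulrC.
Qed.

Lemma mul_1i : left_id (1 +i 0) mul_i.
Proof. by move=> [a b]; rewrite /mul_i /= !mul1r !mul0r subr0 addr0. Qed.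

Lemma mul_iDl : left_distributive mul_i add_i.
Proof.
move=> [a b] [c d] [e f]; rewrite /mul_i /add_i /= !mulrDl !opprD -!addrA.
by congr ((_ + _) +i (_ + _)); rewrite addrCA.
Qed.

Lemma one_i_neq0 : 1 +i 0 != 0 :> adjoin_i A.
Proof. by apply/eqP => -[] /eqP; rewrite oner_eq0. Qed.

HB.instance Definition _ := GRing.Zmodule_isComNzRing.Build (adjoin_i A)
  mul_iA mul_iC mul_1i mul_iDl one_i_neq0.

Lemma scale_iA a b x : scale_i a (scale_i b x) = scale_i (a * b) x.
Proof. by rewrite /scale_i /= !scalerA. Qed.

Lemma scale_1i : left_id 1 scale_i.
Proof. by move=> [a b]; rewrite /scale_i /= !scale1r. Qed.

Lemma scale_iDr : right_distributive scale_i add_i.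
Proof. by move=> a [b c] [d e]; rewrite /scale_i /add_i /= !scalerDr. Qed.

Lemma scale_iDl x : {morph scale_i^~ x : a b / a + b >-> add_i a b}.
Proof. by move=> a b; rewrite /scale_i /add_i /= !scalerDl. Qed.

HB.instance Definition _ := GRing.Zmodule_isLmodule.Build R (adjoin_i A)
  scale_iA scale_1i scale_iDr scale_iDl.

Lemma scale_iAl (a : R) x y : a *: (x * y) = a *: x * y.
Proof. by congr (_ +i _); rewrite /= ?scalerBr ?scalerDr !scalerAl. Qed.

HB.instance Definition _ :=
  GRing.Lmodule_isLalgebra.Build R (adjoin_i A) scale_iAl.
HB.instance Definition _ := GRing.Lalgebra_isComAlgebra.Build R (adjoin_i A).

End AdjoinI.

Fixpoint multicomplex (R : realType) (n : nat) : comAlgType R :=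
  if n is n'.+1 then adjoin_i (multicomplex R n') else R^o.

(* The imaginary unit i_k of M(n), for 1 <= k <= n (and 0 for other k). *)
Fixpoint imunit (R : realType) (n k : nat) : multicomplex R n :=
  if n is n'.+1 return multicomplex R n then
    if k == n'.+1 then 0 +i 1
    else imunit R n' k +i 0
  else 0.

(* I(n); an index k : 'I_n starts at 0 and stands for the unit i_(k + 1). *)
Definition mcunits (R : realType) (n : nat) : set (multicomplex R n) :=
  [set u | exists A : {set 'I_n}, u = \prod_(k in A) imunit R n k.+1]%classic.
Arguments mcunits : clear implicits.

Definition lin_span (R : pzRingType) (V : lmodType R) (S : set V) : set V :=
  [set v | exists (k : nat) (a : 'I_k -> R) (u : 'I_k -> V),
     (forall i, S (u i)) /\ v = \sum_(i < k) a i *: u i]%classic.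

Section Subspaces.
Variables (R : realType) (n : nat).
Local Notation M := (multicomplex R n).

Definition Q (p : nat) (c x : M) : M := x ^+ p + c.

Definition Tspan (im ik il : M) : set M :=
  lin_span [set im; ik; il]%classic.

Definition Itspan (p : nat) (im ik il : M) : set M :=
  lin_span [set v | exists c t,
    [/\ Tspan im ik il c, (1 <= t)%N & v = iter t (Q p c) 0]]%classic.

Definition Mspan (im ik il : M) : set M :=
  lin_span [set im; ik; il; im * ik * il]%classic.

Definition Sspan (im ik il : M) : set M :=
  lin_span [set 1; im; ik; il; im * ik; im * il; ik * il; im * ik * il]%classic.

End Subspaces.

(* Main.v *)
Require Import Defs.
From mathcomp Require Import all_boot all_order all_algebra.
From mathcomp Require Import boolp classical_sets reals.
Set Implicit Arguments.
Unset Strict Implicit.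
Import Order.TTheory GRing.Theory Num.Theory.
Local Open Scope ring_scope.

(** Write W = It^p(im, ik, il) and T = T(im, ik, il).  Since Q_c(0) = c and
    Q_c^2(0) = c^p + c, W contains T and all c^p with c in T.  A subspace that
    contains all values of a polynomial function R -> M(n) contains its
    coefficients; applied to (s c)^(...) and to (c + s x)^q this gives that W
    contains c^(2p-1) (from Q_c^3(0)) and, by polarization, the products
    c^(q-2) x y with c, x, y in T and q = p or q = 2p - 1.  As units square to
    +-1, this yields ik il or im ik il according to the parity of q.
    Conversely, the right-hand sides are stable under x |-> x^p because, up to
    sign, they are spanned by all monomials in the units, or by all monomials
    of odd degree. *)

(** * Subspaces and linear spans *)

Section LinearSpan.
Local Open Scope classical_set_scope.

Definition subspace (R : pzRingType) (V : lmodType R) (W : set V) : Prop :=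
  W 0 /\ forall (a : R) x y, W x -> W y -> W (a *: x + y).

Section Subspace.
Variables (R : pzRingType) (V : lmodType R) (W : set V).
Hypothesis HW : subspace W.

Lemma subspaceD x y : W x -> W y -> W (x + y).
Proof. by move=> Wx Wy; rewrite -[x]scale1r; apply: HW.2. Qed.

Lemma subspaceZ a x : W x -> W (a *: x).
Proof. by move=> Wx; rewrite -[_ *: _]addr0; apply: HW.2 => //; apply: HW.1. Qed.

Lemma subspaceB x y : W x -> W y -> W (x - y).
Proof. by move=> Wx Wy; rewrite -scaleN1r addrC; apply: HW.2. Qed.

Lemma subspace_sum (I : Type) (r : seq I) (P : pred I) (F : I -> V) :
  (forall i, P i -> W (F i)) -> W (\sum_(i <- r | P i) F i).
Proof. by move=> WF; apply: big_ind => //; [exact: HW.1 | exact: subspaceD]. Qed.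

Lemma lin_span_sub (S : set V) : S `<=` W -> lin_span S `<=` W.
Proof.
move=> SW _ [k [a [u [Su ->]]]].
by apply: subspace_sum => i _; apply: subspaceZ; apply: SW.
Qed.

End Subspace.

Lemma subspaceVZ (F : fieldType) (V : lmodType F) (W : set V) (a : F) x :
  subspace W -> a != 0 -> W (a *: x) -> W x.
Proof.
move=> HW a0 /(subspaceZ HW a^-1).
by rewrite scalerA mulVf // scale1r.
Qed.

Lemma subspace_lin_span (R : pzRingType) (V : lmodType R) (S : set V) :
  subspace (lin_span S).
Proof.
split.
  exists 0%N, (fun=> 0), (fun=> 0); split; first by case.
  by rewrite big_ord0.
move=> a _ _ [k [b [u [Su ->]]]] [k' [b' [u' [Su' ->]]]].
exists (k + k')%N.
exists (fun i => match split i with inl j => a * b j | inr j => b' j end).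
exists (fun i => match split i with inl j => u j | inr j => u' j end).
split; first by move=> i; case: (split i).
rewrite big_split_ord scaler_sumr; congr (_ + _); apply: eq_bigr => i _.
  by rewrite scalerA -[lshift _ _]/(unsplit (inl i)) unsplitK.
by rewrite -[rshift _ _]/(unsplit (inr i)) unsplitK.
Qed.

Lemma sub_lin_span (R : pzRingType) (V : lmodType R) (S : set V) :
  S `<=` lin_span S.
Proof.
move=> x Sx; exists 1%N, (fun=> 1), (fun=> x); split => //.
by rewrite big_ord1 scale1r.
Qed.

Lemma subspace_preimage_mulr (R : pzRingType) (A : lalgType R) (W : set A)
    (z : A) :
  subspace W -> subspace [set x | W (x * z)].
Proof.
move=> HW; split; first by rewrite /= mul0r; apply: HW.1.
by move=> a x y /= Wx Wy; rewrite mulrDl -scalerAl; apply: HW.2.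
Qed.

(** Bilinearity: with one factor fixed, the other ranges over a subspace, so each factor in turn
    reduces to generators. *)
Lemma lin_span_mul (R : comNzRingType) (A : comAlgType R) (S S' W : set A) x y :
  subspace W -> (forall u v, S u -> S' v -> W (u * v)) ->
  lin_span S x -> lin_span S' y -> W (x * y).
Proof.
move=> HW SS' Sx Sy.
apply: (lin_span_sub (subspace_preimage_mulr y HW) _ Sx) => u Su /=.
rewrite mulrC.
apply: (lin_span_sub (subspace_preimage_mulr u HW) _ Sy) => v Sv /=.
by rewrite mulrC; apply: SS'.
Qed.

End LinearSpan.

(** * Coefficient extraction and polarization *)

(* Induction on [d]: [f(2s) - 2^(e d) f(s)] has no term of degree [e d]. *)
Lemma subspace_coef (R : numFieldType) (V : lmodType R) (W : set V)
    (e : nat -> nat) (d : nat) (v : nat -> V) :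
  injective e -> subspace W -> (forall s : R, W (\sum_(i < d) s ^+ e i *: v i)) ->
  forall i, (i < d)%N -> W (v i).
Proof.
move=> e_inj HW; elim: d v => [//|d IHd] v Wv.
have Wlt i : (i < d)%N -> W (v i).
  move=> lt_id.
  have nz : 2 ^+ e i - 2 ^+ e d != 0 :> R.
    by rewrite subr_eq0 -!natrX eqr_nat eqn_exp2l // (inj_eq e_inj) ltn_eqF.
  apply: (subspaceVZ HW nz).
  apply: (IHd (fun i => (2 ^+ e i - 2 ^+ e d) *: v i)) lt_id => s.
  have := subspaceB HW (Wv (2 * s)) (subspaceZ HW (2 ^+ e d) (Wv s)).
  rewrite !big_ord_recr /= scalerDr opprD addrACA scalerA exprMn subrr addr0.
  rewrite scaler_sumr -sumrB; congr W; apply: eq_bigr => j _.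
  by rewrite !scalerA -scalerBl exprMn mulrBr !(mulrC (s ^+ e j)).
move=> i; rewrite ltnS leq_eqVlt => /orP[/eqP->|]; last exact: Wlt.
(* At [s = 1] the sum is the plain sum of the [v i]; removing the lower ones leaves [v d]. *)
have := Wv 1; rewrite big_ord_recr /= expr1n scale1r => Wd.
rewrite -[v d](addKr (\sum_(j < d) 1 ^+ e j *: v j)) addrC.
apply: subspaceB => //; apply: subspace_sum => // j _.
by apply: subspaceZ => //; apply: Wlt.
Qed.

(** The coefficient of [s] in [(c + s x)^(q+1) z] is [(q+1) c^q x z]. The spare factor [z] allows a
    second polarization. *)
Lemma subspace_polarize (R : numFieldType) (A : comAlgType R) (T W : set A)
    (q : nat) (z : A) :
  subspace T -> subspace W -> (forall c, T c -> W (c ^+ q.+1 * z)) ->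
  forall c x, T c -> T x -> W (c ^+ q * (x * z)).
Proof.
move=> HT HW Wpow c x Tc Tx.
pose v i := (c ^+ (q.+1 - i) * x ^+ i * z) *+ 'C(q.+1, i).
have nz : q.+1%:R != 0 :> R by rewrite pnatr_eq0.
apply: (subspaceVZ HW nz).
have -> : q.+1%:R *: (c ^+ q * (x * z)) = v 1%N.
  by rewrite /v bin1 subn1 expr1 scaler_nat mulrA.
apply: (subspace_coef (e := id) (d := q.+2)) => // s.
have := Wpow _ (HT.2 s _ _ Tx Tc).
rewrite addrC exprDn mulr_suml; congr W; apply: eq_bigr => i _.
by rewrite /v exprZn -scalerAr mulrnAl -scalerAl scalerMnr.
Qed.

(** Each pair [u * u] contributes a factor [a], so up to a nonzero scalar only the parity of [n]
    matters. *)
Lemma exp_scalar_sqr (R : fieldType) (A : comAlgType R) (a : R) (u : A) n :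
  a != 0 -> u * u = a *: 1 -> exists2 b, b != 0 & u ^+ n = b *: u ^+ odd n.
Proof.
move=> a0 uu; exists (a ^+ n./2); first exact: expf_neq0.
rewrite -{1}(odd_double_half n) exprD -mul2n exprM expr2 uu exprZn expr1n.
by rewrite -scalerAr mulr1.
Qed.

Lemma subspace_exp_scalar_sqr (R : fieldType) (A : comAlgType R) (W : set A)
    (u x : A) n :
  subspace W -> (exists2 a : R, a != 0 & u * u = a *: 1) ->
  W (u ^+ n * x) -> W (u ^+ odd n * x).
Proof.
move=> HW [a a0 uu]; have [b b0 ->] := exp_scalar_sqr n a0 uu.
by rewrite -scalerAl; apply: subspaceVZ.
Qed.

(** * Monomials in three elements *)

Section Monomials.
Local Open Scope classical_set_scope.
Variables (R : fieldType) (A : comAlgType R) (m k l : A).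

(** [D] restricts the total degree only. Exponents are unbounded, so products of monomials are again
    monomials without any reduction. *)
Definition monomials (D : set nat) : set A :=
  [set u | exists i j h, D (i + j + h)%N /\ u = m ^+ i * k ^+ j * l ^+ h].

(** [D a] collects the degrees allowed in an [a]-th power. Indexing by [a] is what handles
    odd-degree monomials, whose successive powers alternate in parity. *)
Lemma span_monomials_exp (D : nat -> set nat) x n :
  D 0%N 0%N -> (forall a i j, D 1%N i -> D a j -> D a.+1 (i + j)%N) ->
  lin_span (monomials (D 1%N)) x -> lin_span (monomials (D n)) (x ^+ n).
Proof.
move=> D0 DS Sx; elim: n => [|n IHn].
  by apply: sub_lin_span; exists 0%N, 0%N, 0%N; rewrite !mulr1.
rewrite exprS; apply: lin_span_mul Sx IHn; first exact: subspace_lin_span.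
move=> _ _ [i [j [h [Dijh ->]]]] [i' [j' [h' [Dijh' ->]]]].
apply: sub_lin_span; exists (i + i')%N, (j + j')%N, (h + h')%N; split.
  by rewrite (addnACA i) addnACA; apply: DS.
by rewrite !exprD mulrACA [X in X * _ = _]mulrACA.
Qed.

Hypothesis Hm : exists2 a : R, a != 0 & m * m = a *: 1.
Hypothesis Hk : exists2 a : R, a != 0 & k * k = a *: 1.
Hypothesis Hl : exists2 a : R, a != 0 & l * l = a *: 1.

(** Reducing each exponent modulo 2 costs a scalar and preserves the parity of the total degree. *)
Lemma monomials_sub (D : set bool) (W : set A) :
  subspace W ->
  (forall a b c : bool, D (odd (a + b + c)) -> W (m ^+ a * k ^+ b * l ^+ c)) ->
  lin_span (monomials [set n | D (odd n)]) `<=` W.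
Proof.
move=> HW Wabc; apply: lin_span_sub => // _ [i [j [h [Dijh ->]]]].
have [a a0 mm] := Hm; have [b b0 kk] := Hk; have [c c0 ll] := Hl.
have [a' _ ->] := exp_scalar_sqr i a0 mm.
have [b' _ ->] := exp_scalar_sqr j b0 kk.
have [c' _ ->] := exp_scalar_sqr h c0 ll.
rewrite -!(scalerAl, scalerAr); do 3![apply: subspaceZ => //].
by apply: Wabc; move: Dijh; rewrite /= !oddD !oddb.
Qed.

End Monomials.

Section Multicomplex.
Local Open Scope classical_set_scope.
Variables (R : realType) (n : nat).
Local Notation M := (multicomplex R n).

Lemma imunit_sqr (N j : nat) :
  (j < N)%N -> imunit R N j.+1 * imunit R N j.+1 = - 1.
Proof.
elim: N => [//|N IHN] lt_jN /=; case: eqP => [_|ne_jN].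
  congr AdjoinI; rewrite /= ?(mulr0, mul0r, mul1r, mulr1, sub0r, add0r, addr0) //.
  by rewrite oppr0.
have lt : (j < N)%N.
  by rewrite ltn_neqAle -ltnS lt_jN andbT; apply/eqP => e; case: ne_jN; rewrite e.
congr AdjoinI; rewrite /= ?(mulr0, mul0r, subr0, addr0, oppr0) //.
exact: IHN.
Qed.

Lemma mcunits_sqr (u : M) :
  mcunits R n u -> exists2 a : R, a != 0 & u * u = a *: 1.
Proof.
move=> [B ->]; exists ((-1) ^+ #|B|); first by rewrite signr_eq0.
rewrite -big_split /= (eq_bigr (fun=> -1)) => [|j _]; last exact: imunit_sqr.
by rewrite prodr_const -scaleN1r exprZn expr1n.
Qed.

(** * Bounds on the span of the iterates *)

Section Iterates.
Variables (p : nat) (im ik il : M).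
Hypothesis hp : (2 <= p)%N.
Local Notation T := (Tspan im ik il).
Local Notation W := (Itspan p im ik il).

(** The orbit starts at 0 and [Q p c] maps [V] into itself once [c] is in [V]. *)
Lemma Itspan_sub (V : set M) :
  subspace V -> (forall x, V x -> V (x ^+ p)) ->
  V im -> V ik -> V il -> W `<=` V.
Proof.
move=> HV Vp Vm Vk Vl; apply: lin_span_sub => // _ [c [t [Tc _ ->]]].
have Vc : V c by apply: (lin_span_sub HV _ Tc) => _ [[|]|] ->.
elim: t => [|t IHt]; first exact: HV.1.
by rewrite iterS; apply: subspaceD => //; apply: Vp.
Qed.

Lemma subspace_Itspan : subspace W.
Proof. exact: subspace_lin_span. Qed.

Lemma Tspan_units : [/\ T im, T ik & T il].
Proof. by split; apply: sub_lin_span; [left; left | left; right | right]. Qed.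

Lemma Q0 (c : M) : Q p c 0 = c.
Proof. by rewrite /Q expr0n gtn_eqF ?add0r // ltnW. Qed.

Lemma Tspan_sub_Itspan : T `<=` W.
Proof.
by move=> c Tc; apply: sub_lin_span; exists c, 1%N; rewrite /= Q0.
Qed.

Lemma Itspan_expp c : T c -> W (c ^+ p).
Proof.
move=> Tc; rewrite -[_ ^+ p](addrK c).
apply: subspaceB; [exact: subspace_Itspan | | exact: Tspan_sub_Itspan].
by apply: sub_lin_span; exists c, 2; rewrite /= Q0.
Qed.

(* [p c^(2p-1)] is the homogeneous component of degree [2p-1] of
   [Q_c^3(0) - c = (c^p + c)^p] as a function of [c]. *)
Lemma Itspan_exp2p1 c : T c -> W (c ^+ (p + p.-1)).
Proof.
move=> Tc; have HW := subspace_Itspan.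
have nz : p%:R != 0 :> R by rewrite pnatr_eq0 -lt0n ltnW.
apply: (subspaceVZ HW nz).
(* Binomial term of [(c + c^p)^p] with [j] factors [c^p], of degree [(p - j) + p j]. *)
pose v j := c ^+ (p + j * p.-1) *+ 'C(p, j).
have -> : p%:R *: c ^+ (p + p.-1) = v 1%N by rewrite /v bin1 mul1n scaler_nat.
(* Distinct [j] give distinct degrees because [p - 1 > 0]. *)
have e_inj : injective (fun j => p + j * p.-1)%N.
  by move=> i j /addnI/eqP; rewrite eqn_pmul2r -?subn1 ?subn_gt0 // => /eqP.
apply: (subspace_coef (d := p.+1) e_inj HW) => [s|]; last by rewrite ltnS ltnW.
have Tsc : T (s *: c) by apply: subspaceZ Tc; apply: subspace_lin_span.
have -> : \sum_(j < p.+1) s ^+ (p + j * p.-1) *: v j =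
          iter 3 (Q p (s *: c)) 0 - s *: c.
  rewrite /= Q0 /Q addrK addrC exprDn; apply: eq_bigr => j _.
  rewrite -exprM -exprD exprZn scalerMnr.
  have -> // : (p - j + p * j = p + j * p.-1)%N.
  rewrite -subn1 mulnBr muln1 mulnC addnBAC -1?ltnS // addnBA //.
  by rewrite leq_pmulr // ltnW.
apply: subspaceB => //; last exact: Tspan_sub_Itspan.
by apply: sub_lin_span; exists (s *: c), 3.
Qed.

(** Two polarizations: [c^(q+2)] yields [c^(q+1) y] (spare factor 1), which yields [c^q x y] (spare
    factor [y]). *)
Lemma Itspan_expM2 q c x y :
  (forall c, T c -> W (c ^+ q.+2)) -> T c -> T x -> T y -> W (c ^+ q * (x * y)).
Proof.
move=> Wq Tc Tx Ty; have HT : subspace T by exact: subspace_lin_span.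
have HW := subspace_Itspan.
apply: (@subspace_polarize _ _ T) => // {c x Tc Tx} c Tc.
rewrite -[y]mulr1; apply: (@subspace_polarize _ _ T) => // {c y Tc Ty} c Tc.
by rewrite mulr1; apply: Wq.
Qed.

(** Put [c = im] in [c^r ik il] with [r] odd: [im^r] is a nonzero multiple of [im]. For odd [p],
    [r = p - 2]; for even [p], [r = 2p - 3]. *)
Lemma Itspan_mul3 :
  (exists2 a : R, a != 0 & im * im = a *: 1) -> W (im * ik * il).
Proof.
move=> sqm; have [Tm Tk Tl] := Tspan_units; have HW := subspace_Itspan.
have [q def_p] : exists q, p = q.+2 by exists (p - 2)%N; rewrite -addn2 subnK.
have Wq r : odd r -> (forall c, T c -> W (c ^+ r.+2)) -> W (im * ik * il).
  move=> r_odd Wr; rewrite -mulrA -[im in im * _]expr1.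
  have -> : 1%N = odd r by rewrite r_odd.
  by apply: subspace_exp_scalar_sqr => //; apply: Itspan_expM2.
have [q_odd | q_even] := boolP (odd q).
  by apply: (Wq q) => // c; rewrite -def_p; apply: Itspan_expp.
apply: (Wq (q + q.+1)%N) => [|c]; first by rewrite oddD /= (negPf q_even).
by have := @Itspan_exp2p1 c; rewrite def_p /= addSn addSn.
Qed.

(** Here [im^(p-2)] is a nonzero scalar, since [p - 2] is even. *)
Lemma Itspan_even_mul x y :
  ~~ odd p -> (exists2 a : R, a != 0 & im * im = a *: 1) ->
  T x -> T y -> W (x * y).
Proof.
move=> p_even sqm Tx Ty; have [Tm _ _] := Tspan_units.
have [q def_p] : exists q, p = q.+2 by exists (p - 2)%N; rewrite -addn2 subnK.
have q_even : odd q = false by move: p_even; rewrite def_p /= negbK => /negPf.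
have /(subspace_exp_scalar_sqr subspace_Itspan sqm) : W (im ^+ q * (x * y)).
  by apply: Itspan_expM2 => // c; rewrite -def_p; apply: Itspan_expp.
by rewrite q_even mul1r.
Qed.

Lemma Itspan_even_1 :
  ~~ odd p -> (exists2 a : R, a != 0 & im * im = a *: 1) -> W 1.
Proof.
move=> p_even sqm; have [a a0 mm] := sqm; have [Tm _ _] := Tspan_units.
by apply: (subspaceVZ subspace_Itspan a0); rewrite -mm; apply: Itspan_even_mul.
Qed.

End Iterates.

(** * Stability of the target spaces under [p]-th powers *)

Section Stability.
Variables (p : nat) (m k l : M).
Hypothesis sqm : exists2 a : R, a != 0 & m * m = a *: 1.
Hypothesis sqk : exists2 a : R, a != 0 & k * k = a *: 1.
Hypothesis sql : exists2 a : R, a != 0 & l * l = a *: 1.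

Lemma exp_Mspan x : odd p -> Mspan m k l x -> Mspan m k l (x ^+ p).
Proof.
move=> p_odd Mx; have HV : subspace (Mspan m k l) by exact: subspace_lin_span.
apply: (monomials_sub sqm sqk sql (D := [set b : bool | b]) HV).
  by move=> [] [] [] //= _; apply: sub_lin_span => /=;
    rewrite ?expr0 ?expr1 ?mulr1 ?mul1r; tauto.
(* The odd degrees are recast as the degrees with the parity of [p], the member at [p] of a family
   indexed by the exponent. *)
have -> : [set d | [set b : bool | b] (odd d)] = [set d | odd d = odd p].
  by rewrite p_odd; apply/seteqP; split => d /=.
apply: (@span_monomials_exp _ _ _ _ _ (fun a => [set d | odd d = odd a])) => //=.
  by move=> a i j; rewrite oddD => -> ->.
apply: (lin_span_sub (subspace_lin_span _) _ Mx) => _ [[[|]|]|] -> /=;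
  apply: sub_lin_span.
- by exists 1%N, 0%N, 0%N; rewrite !mulr1.
- by exists 0%N, 1%N, 0%N; rewrite mulr1 mul1r.
- by exists 0%N, 0%N, 1%N; rewrite !mul1r.
- by exists 1%N, 1%N, 1%N.
Qed.

Lemma exp_Sspan x : Sspan m k l x -> Sspan m k l (x ^+ p).
Proof.
move=> Sx; have HV : subspace (Sspan m k l) by exact: subspace_lin_span.
apply: (monomials_sub sqm sqk sql (D := setT) HV).
  by move=> [] [] [] _; apply: sub_lin_span => /=;
    rewrite ?expr0 ?expr1 ?mulr1 ?mul1r; tauto.
apply: (@span_monomials_exp _ _ _ _ _ (fun=> setT)) => //=.
apply: (lin_span_sub (subspace_lin_span _) _ Sx) => _ [[[[[[[|]|]|]|]|]|]|] -> /=;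
  apply: sub_lin_span.
- by exists 0%N, 0%N, 0%N; rewrite !mulr1.
- by exists 1%N, 0%N, 0%N; rewrite !mulr1.
- by exists 0%N, 1%N, 0%N; rewrite mulr1 mul1r.
- by exists 0%N, 0%N, 1%N; rewrite !mul1r.
- by exists 1%N, 1%N, 0%N; rewrite mulr1.
- by exists 1%N, 0%N, 1%N; rewrite mulr1.
- by exists 0%N, 1%N, 1%N; rewrite mul1r.
- by exists 1%N, 1%N, 1%N.
Qed.

End Stability.

(** Gives stability of [Mspan 1 k l] for even [p], where [exp_Mspan] does not apply. *)
Lemma Mspan1E (k l : M) : Mspan 1 k l = Sspan 1 k l.
Proof.
by apply/seteqP; split; apply: (lin_span_sub (subspace_lin_span _)) => x /= Sx;
  apply: sub_lin_span => /=; move: Sx; rewrite ?mul1r; tauto.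
Qed.

End Multicomplex.

(* The hypotheses ik <> 1 and il <> 1 are the standing convention: a unit equal
   to 1 can only be im. *)
Theorem theorem4 (R : realType) (n p : nat) (im ik il : multicomplex R n)
    (hp : (2 <= p)%N)
    (hm : mcunits R n im) (hk : mcunits R n ik) (hl : mcunits R n il)
    (hmk : im <> ik) (hml : im <> il) (hkl : ik <> il)
    (hk1 : ik <> 1) (hl1 : il <> 1) :
  [/\ ~~ odd p -> im = 1 \/ (ik * il = im \/ ik * il = - im) ->
        Itspan p im ik il = Mspan 1 ik il,
      ~~ odd p -> im <> 1 -> ~ (ik * il = im \/ ik * il = - im) ->
        Itspan p im ik il = Sspan im ik il &
      odd p -> Itspan p im ik il = Mspan im ik il].
Proof.
have sqm := mcunits_sqr hm; have sqk := mcunits_sqr hk.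
have sql := mcunits_sqr hl.
(* In the first case [exp_Sspan] is applied with 1 in place of [im]. *)
have sq1 : exists2 a : R, a != 0 & 1 * 1 = a *: 1 :> multicomplex R n.
  by exists 1; rewrite ?oner_eq0 // scale1r mul1r.
have HW := @subspace_Itspan R n p im ik il.
have [Tm Tk Tl] := Tspan_units im ik il.
have WT := @Tspan_sub_Itspan R n p im ik il hp.
split=> [p_even im_kl|p_even _ _|p_odd]; apply/seteqP; split.
- have HV : subspace (Sspan 1 ik il) by exact: subspace_lin_span.
  have Vkl : Sspan 1 ik il (ik * il).
    by apply: sub_lin_span; left; right.
  rewrite Mspan1E; apply: Itspan_sub => //.
  + by move=> x; apply: exp_Sspan.
  + case: im_kl => [->|[<- //|kl]].
      by apply: sub_lin_span => /=; tauto.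
    by rewrite -[im]opprK -kl -scaleN1r; apply: subspaceZ.
  + by apply: sub_lin_span => /=; tauto.
  + by apply: sub_lin_span => /=; tauto.
- apply: (lin_span_sub HW) => _ [[[|]|]|] ->;
    [exact: Itspan_even_1 | exact: WT | exact: WT |].
  by rewrite mul1r; apply: Itspan_even_mul.
- apply: Itspan_sub.
  + exact: subspace_lin_span.
  + by move=> x; apply: exp_Sspan.
  + by apply: sub_lin_span => /=; tauto.
  + by apply: sub_lin_span => /=; tauto.
  + by apply: sub_lin_span => /=; tauto.
- apply: (lin_span_sub HW) => _ [[[[[[[|]|]|]|]|]|]|] -> /=;
    by [exact: Itspan_even_1 | exact: WT | apply: Itspan_even_mul
       | exact: Itspan_mul3].
- apply: Itspan_sub.
  + exact: subspace_lin_span.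
  + by move=> x; apply: exp_Mspan.
  + by apply: sub_lin_span => /=; tauto.
  + by apply: sub_lin_span => /=; tauto.
  + by apply: sub_lin_span => /=; tauto.
- apply: (lin_span_sub HW) => _ [[[|]|]|] ->;
    [exact: WT | exact: WT | exact: WT |].
  exact: Itspan_mul3.
Qed.
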